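(* Let $\mu>0$, let $\Lambda_D,\Lambda_N,\Lambda_{\tilde N},\Lambda_R$ be the minimization levels defined in the context, and let $\lambda_D,\lambda_N,\lambda_{\tilde N},\lambda_R$ be corresponding eigenvalues, i.e. eigenvalues of the Dirichlet, Neumann, regional Neumann and Robin problems whose eigenfunctions are functions attaining $\Lambda_D,\Lambda_N,\Lambda_{\tilde N},\Lambda_R$, respectively. Then $$ \frac{p^-}{p^+} \Lambda \leq \lambda \leq \frac{p^+}{p^-} \Lambda $$ for each pair $(\Lambda,\lambda)\in\{(\Lambda_D,\lambda_D),(\Lambda_R,\lambda_R),(\Lambda_N,\lambda_N),(\Lambda_{\tilde N},\lambda_{\tilde N})\}$. Consequently, denoting $c=p^+/p^-$, $$ \lambda_{\tilde N}\leq c^2\lambda_N \leq c^4 \lambda_R\leq c^6 \lambda_D. $$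
   Context: Let $s\in(0,1)$, let $\Omega\subset\mathbb{R}^n$ be a bounded open set with $C^{0,1}$ boundary, $\Omega^c=\mathbb{R}^n\setminus\Omega$, and let $\beta\in L^\infty(\mathbb{R}^n\setminus\Omega)$ be strictly positive. $G\colon[0,\infty)\to[0,\infty)$ is a Young function: $G(t)=\int_0^t g(\tau)\,d\tau$, with $g$ right continuous and nondecreasing, $g(0)=0$, $g(t)>0$ for $t>0$, $\lim_{t\to\infty}g(t)=\infty$, and $g=G'$. It satisfies: $1<p^-\leq \frac{tg(t)}{G(t)}\leq p^+<\infty$ for all $t>0$, for fixed constants $p^\pm$; $t\mapsto G(\sqrt t)$ is convex on $[0,\infty)$; $\int_0^1 \frac{G^{-1}(\tau)}{\tau^{(n+s)/n}}d\tau<\infty$ and $\int_1^\infty \frac{G^{-1}(\tau)}{\tau^{(n+s)/n}}d\tau=\infty$. Notation: $D_su(x,y)=\frac{u(x)-u(y)}{|x-y|^s}$, $d\mu=\frac{dx\,dy}{|x-y|^n}$ (unrelated to the number $\mu$); $g(|r|)\frac{r}{|r|}$ is read as $0$ when $r=0$. Modulars: $\Phi_{G,\Omega}(u)=\int_\Omega G(|u|)\,dx$, $\Phi_{s,G,\mathbb{R}^n}(u)=\iint_{\mathbb{R}^n\times\mathbb{R}^n}G(|D_su|)\,d\mu$, $\Phi_{s,G,\Omega}(u)=\iint_{\Omega\times\Omega}G(|D_su|)\,d\mu$, $\Phi_{s,G,*}(u)=\iint_{\mathbb{R}^{2n}\setminus(\Omega^c)^2}G(|D_su|)\,d\mu$,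 $\Phi_{G,\beta,\Omega^c}(u)=\int_{\mathbb{R}^n\setminus\Omega}\beta\,G(|u|)\,dx$. Spaces (of measurable functions): $W^{s,G}_0(\Omega)=\{u\colon\mathbb{R}^n\to\mathbb{R}: \int_{\mathbb{R}^n}G(|u|)\,dx<\infty,\ \Phi_{s,G,\mathbb{R}^n}(u)<\infty,\ u=0 \text{ a.e. in }\mathbb{R}^n\setminus\Omega\}$; $W^{s,G}_*(\Omega)=\{u\colon\mathbb{R}^n\to\mathbb{R}: \Phi_{G,\Omega}(u)<\infty,\ \Phi_{s,G,*}(u)<\infty\}$; $W^{s,G}_{reg}(\Omega)=\{u\colon\Omega\to\mathbb{R}: \Phi_{G,\Omega}(u)<\infty,\ \Phi_{s,G,\Omega}(u)<\infty\}$; $\mathcal{X}=\{u\in W^{s,G}_*(\Omega): \Phi_{G,\beta,\Omega^c}(u)<\infty\}$. For $\mu>0$: $\Lambda_D=\inf\left\{\frac{\Phi_{s,G,\mathbb{R}^n}(u)+\Phi_{G,\Omega}(u)}{\Phi_{G,\Omega}(u)}: u\in W^{s,G}_0(\Omega),\ \Phi_{G,\Omega}(u)=\mu\right\}$, $\Lambda_N=\inf\left\{\frac{\Phi_{s,G,*}(u)+\Phi_{G,\Omega}(u)}{\Phi_{G,\Omega}(u)}: u\in W^{s,G}_*(\Omega),\ \Phi_{G,\Omega}(u)=\mu\right\}$, $\Lambda_{\tilde N}=\inf\left\{\frac{\Phi_{s,G,\Omega}(u)+\Phi_{G,\Omega}(u)}{\Phi_{G,\Omega}(u)}: u\in W^{s,G}_{reg}(\Omega),\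 \Phi_{G,\Omega}(u)=\mu\right\}$, $\Lambda_R=\inf\left\{\frac{\Phi_{s,G,*}(u)+\Phi_{G,\Omega}(u)+\Phi_{G,\beta,\Omega^c}(u)}{\Phi_{G,\Omega}(u)}: u\in\mathcal{X},\ \Phi_{G,\Omega}(u)=\mu\right\}$. Forms: $\langle(-\Delta_g)^su,v\rangle$, $\langle(-\Delta_g)_\Omega^su,v\rangle$ and $\langle(-\Delta_g)^su,v\rangle_*$ denote $\iint_E g(|D_su|)\frac{D_su}{|D_su|}D_sv\,d\mu$ with $E=\mathbb{R}^n\times\mathbb{R}^n$, $E=\Omega\times\Omega$ and $E=\mathbb{R}^{2n}\setminus(\Omega^c)^2$, respectively. Eigenvalues: $\lambda$ is an eigenvalue with eigenfunction $u$ of - the Dirichlet problem if $u\in W^{s,G}_0(\Omega)$ and $\langle(-\Delta_g)^su,v\rangle=(\lambda-1)\int_\Omega g(|u|)\frac{u}{|u|}v\,dx$ for all $v\in W^{s,G}_0(\Omega)$; - the Neumann problem if $u\in W^{s,G}_*(\Omega)$ and $\langle(-\Delta_g)^su,v\rangle_*=(\lambda-1)\int_\Omega g(|u|)\frac{u}{|u|}v\,dx$ for all $v\in W^{s,G}_*(\Omega)$; - the regional Neumann problem if $u\in W^{s,G}_{reg}(\Omega)$ and $\langle(-\Delta_g)_\Omega^su,v\rangle=(\lambda-1)\int_\Omega g(|u|)\frac{u}{|u|}v\,dx$ for all $v\in W^{s,G}_{reg}(\Omega)$; - the Robin problem if $u\in\mathcal{X}$ and $\langle(-\Delta_g)^su,v\rangle_*=(\lambda-1)\int_\Omega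 g(|u|)\frac{u}{|u|}v\,dx-\int_{\mathbb{R}^n\setminus\Omega}\beta\,g(|u|)\frac{u}{|u|}v\,dx$ for all $v\in\mathcal{X}$. *)

(* Defs.v *)
From HB Require Import structures.
From mathcomp Require Import all_boot all_order all_algebra.
From mathcomp Require Import all_classical all_reals all_analysis.

Set Implicit Arguments.
Unset Strict Implicit.
Unset Printing Implicit Defensive.

Import Order.TTheory GRing.Theory Num.Theory.
Import numFieldNormedType.Exports.

Local Open Scope classical_set_scope.
Local Open Scope ring_scope.

(* The sigma-algebra generated by the coordinates, as the library does for
   [n.-tuple R]; it is the Borel sigma-algebra of R^n. *)
Section rV_measurable.
Context {R : realType} {n : nat}.

Let coors : 'I_n -> 'rV[R]_n -> R := fun i x => x ord0 i.

Let rV_set0 : g_sigma_preimage coors set0.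
Proof. exact: sigma_algebra0. Qed.

Let rV_setC A : g_sigma_preimage coors A -> g_sigma_preimage coors (~` A).
Proof. exact: sigma_algebraC. Qed.

Let rV_bigcup (F : (set 'rV[R]_n)^nat) :
  (forall i, g_sigma_preimage coors (F i)) ->
  g_sigma_preimage coors (\bigcup_i (F i)).
Proof. exact: sigma_algebra_bigcup. Qed.

HB.instance Definition _ :=
  @isMeasurable.Build (measure_tuple_display default_measure_display)
    'rV[R]_n (g_sigma_preimage coors) rV_set0 rV_setC rV_bigcup.

End rV_measurable.

Section rV_measurable_lemmas.
Context {R : realType}.

Lemma measurable_coord n (i : 'I_n) :
  measurable_fun [set: 'rV[R]_n] (fun x : 'rV[R]_n => x ord0 i).
Proof.
move=> _ Y mY; rewrite setTI; apply: sub_sigma_algebra => /=.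
rewrite -bigcup_seq/=; exists i => /=; first by rewrite mem_index_enum.
by exists Y => //; rewrite setTI.
Qed.

Lemma measurable_fun_coordP d (T : measurableType d) n (f : T -> 'rV[R]_n) :
  (forall i, measurable_fun [set: T] (fun x => f x ord0 i)) ->
  measurable_fun [set: T] f.
Proof.
move=> mf; have prefS : g_sigma_preimage
    (fun (i : 'I_n) (x : T) => f x ord0 i) `<=` measurable.
  apply: smallest_sub; first exact: sigma_algebra_measurable.
  case: n f mf => [|n] f mf; first by rewrite big_ord0.
  rewrite -bigcup_mkord_ord; apply: bigcup_sub => i Ii.
  by move=> A [B mB <-]; exact: mf.
move=> _ A mA; apply: prefS.
rewrite (g_sigma_preimage_comp (fun (i : 'I_n) (x : 'rV[R]_n) => x ord0 i) f).
by exists A.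
Qed.

Definition rV_cons n (p : measurableTypeR R * 'rV[R]_n) : 'rV[R]_n.+1 :=
  row_mx (p.1 : R)%:M p.2.

Lemma measurable_rV_cons n : measurable_fun setT (@rV_cons n).
Proof.
apply: measurable_fun_coordP => i.
case: (@split_ordP 1 n i) => j ->.
- rewrite (_ : (fun _ => _) = fst); last first.
    by apply/funext => p; rewrite (@row_mxEl R 1 1 n) mxE (ord1 j) eqxx mulr1n.
  exact: measurable_fst.
- rewrite (_ : (fun _ => _) = (fun x : 'rV[R]_n => x ord0 j) \o snd); last first.
    by apply/funext => p; exact: (@row_mxEr R 1 1 n).
  by apply: measurableT_comp; [exact: measurable_coord|exact: measurable_snd].
Qed.

HB.instance Definition _ n :=
  isMeasurableFun.Build _ _ _ _ (@rV_cons n) (@measurable_rV_cons n).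

End rV_measurable_lemmas.

(* The image of [dx \x m] under the identification of R x R^n with R^(n+1). *)
Section lebesgue_rV_succ.
Context {R : realType} {n : nat}.
Variable m : {sigma_finite_measure set 'rV[R]_n -> \bar R}.
Local Open Scope ereal_scope.

Definition lebesgue_rV_succ : set 'rV[R]_n.+1 -> \bar R :=
  pushforward (@lebesgue_measure R \x m) (@rV_cons R n).

Let succ0 : lebesgue_rV_succ set0 = 0.
Proof. exact: measure0. Qed.

Let succ_ge0 A : 0 <= lebesgue_rV_succ A.
Proof. exact: measure_ge0. Qed.

Let succ_sigma_additive : semi_sigma_additive lebesgue_rV_succ.
Proof. exact: measure_semi_sigma_additive. Qed.

HB.instance Definition _ := isMeasure.Build _ _ _
  lebesgue_rV_succ succ0 succ_ge0 succ_sigma_additive.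


Let succ_sigma_finite : sigma_finite setT lebesgue_rV_succ.
Proof.
have /sigma_finiteP[F [TF ndF Foo]] := sigma_finiteT (@lebesgue_measure R).
have /sigma_finiteP[H [TH ndH Hoo]] := sigma_finiteT m.
pose h (x : 'rV[R]_n.+1) : measurableTypeR R * 'rV[R]_n :=
  (x ord0 ord0, \row_j x ord0 (@rshift 1 n j)).
have hK p : h (rV_cons p) = p.
  case: p => a v; rewrite /h /=; congr pair.
    rewrite (_ : ord0 = lshift n (ord0 : 'I_1)); last exact: val_inj.
    by rewrite (@row_mxEl R 1 1 n) mxE eqxx mulr1n.
  by apply/rowP => j; rewrite mxE (@row_mxEr R 1 1 n).
have mh : measurable_fun setT h.
  apply: measurable_fun_pair; first exact: measurable_coord.
  apply: measurable_fun_coordP => i /=.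
  rewrite (_ : (fun _ => _) =
    (fun x : 'rV[R]_n.+1 => x ord0 (@rshift 1 n i))); last first.
    by apply/funext => x; rewrite mxE.
  exact: measurable_coord.
exists (fun k => h @^-1` (F k `*` H k)).
  apply/esym; rewrite -subTset => x _.
  have : (\bigcup_k F k) (h x).1 by rewrite -TF.
  have : (\bigcup_k H k) (h x).2 by rewrite -TH.
  move=> [j _ Hj] [i _ Fi]; exists (maxn i j) => //; split.
  - by move: (h x).1 Fi; exact/subsetPset/ndF/leq_maxl.
  - by move: (h x).2 Hj; exact/subsetPset/ndH/leq_maxr.
move=> k; have [mF Fk] := Foo k; have [mH Hk] := Hoo k; split.
  by rewrite -[X in measurable X]setTI; apply: mh => //; exact: measurableX.
rewrite /lebesgue_rV_succ /pushforward.
rewrite (_ : _ @^-1` _ = F k `*` H k); last first.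
  rewrite -comp_preimage (_ : h \o _ = id) ?preimage_id//.
  by apply/funext => p; exact: hK.
by rewrite product_measure1E// lte_mul_pinfty// ge0_fin_numE.
Qed.

HB.instance Definition _ :=
  Measure_isSigmaFinite.Build _ _ _ lebesgue_rV_succ succ_sigma_finite.

End lebesgue_rV_succ.

(* The n-fold product of [lebesgue_measure]; the base case is the unit mass on
   the one-point space R^0. *)
Fixpoint lebesgue_rV {R : realType} (n : nat) :
    {sigma_finite_measure set 'rV[R]_n -> \bar R} :=
  match n with
  | 0 => @dirac _ _ (0 : 'rV[R]_0) R
  | n'.+1 => lebesgue_rV_succ (lebesgue_rV n')
  end.

Section geometry.
Context {R : realType} {n : nat}.

(* The library norm of ['rV[R]_n] is the sup norm; the kernels need the
   Euclidean one. *)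
Definition enorm (x : 'rV[R]_n) : R := Num.sqrt (\sum_i x ord0 i ^+ 2).

(* C^{0,1} boundary: near each boundary point, and in suitable orthonormal
   coordinates [x *m Q], Omega is the strict epigraph, in the [i]-th coordinate,
   of a Lipschitz function of the n - 1 other coordinates. *)
Definition lipschitz_boundary (Omega : set 'rV[R]_n) : Prop :=
  forall x0 : 'rV[R]_n, (closure Omega `\` Omega°) x0 ->
  exists (Q : 'M[R]_n) (i : 'I_n) (gamma : 'rV[R]_n.-1 -> R^o),
    [/\ Q *m Q^T = 1%:M, lipschitz gamma &
        \forall x \near x0,
          Omega x <-> gamma (col' i (x *m Q)) < (x *m Q) ord0 i].

End geometry.

Section young.
Context {R : realType}.
Implicit Types g G : R -> R.

(* Only the values of [g] and [G] on [0, +oo[ matter. A right continuous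
   density is the derivative of its primitive from the right, and the
   two-sided one where it is continuous: this is the sense of g = G'. *)
Record young_function g G : Prop := {
  young_primitive : forall t, 0 <= t ->
    (G t)%:E = (\int[lebesgue_measure]_(x in `[0%R, t]) (g x)%:E)%E;
  young_rcont : forall t, 0 <= t -> g x @[x --> t^'+] --> g t;
  young_ndecr : forall t u, 0 <= t -> t <= u -> g t <= g u;
  young_g0 : g 0 = 0;
  young_g_gt0 : forall t, 0 < t -> 0 < g t;
  young_g_infty : g x @[x --> +oo] --> +oo;
  young_deriv : forall t, 0 <= t ->
    h^-1 * (G (t + h) - G t) @[h --> 0^'+] --> g t }.

Definition young_inv G : R -> R := 'pinv_(fun=> 0) `[0, +oo[ G.

Definition young_inv_growth (n : nat) (s : R) G : Prop :=
  let f (tau : R) := young_inv G tau / tau `^ ((n%:R + s) / n%:R) in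
  (\int[lebesgue_measure]_(tau in `[0%R, 1%R]) (f tau)%:E < +oo)%E /\
  (\int[lebesgue_measure]_(tau in `[1%R, +oo[) (f tau)%:E = +oo)%E.

End young.

Section modulars.
Context {R : realType} {n : nat}.
Implicit Types (s : R) (g G : R -> R) (beta u v : 'rV[R]_n -> R).
Implicit Types (Omega : set 'rV[R]_n) (E : set ('rV[R]_n * 'rV[R]_n)).

Definition Ds s u (z : 'rV[R]_n * 'rV[R]_n) : R :=
  (u z.1 - u z.2) / enorm (z.1 - z.2) `^ s.

Definition Phi G Omega u : \bar R :=
  \int[lebesgue_rV n]_(x in Omega) (G `|u x|)%:E.

Definition Phi_beta G beta Omega u : \bar R :=
  \int[lebesgue_rV n]_(x in ~` Omega) (beta x * G `|u x|)%:E.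

Definition Phi_s s G E u : \bar R :=
  \int[(lebesgue_rV n \x lebesgue_rV n)%E]_(z in E)
    (G `|Ds s u z| / enorm (z.1 - z.2) ^+ n)%:E.

(* The division by 0 convention makes [g `|r| * (r / `|r|)] vanish at r = 0. *)
Definition form_s s g E u v : \bar R :=
  \int[(lebesgue_rV n \x lebesgue_rV n)%E]_(z in E)
    (g `|Ds s u z| * (Ds s u z / `|Ds s u z|) * Ds s v z
       / enorm (z.1 - z.2) ^+ n)%:E.

Definition form_0 g Omega u v : \bar R :=
  \int[lebesgue_rV n]_(x in Omega) (g `|u x| * (u x / `|u x|) * v x)%:E.

Definition form_beta g beta Omega u v : \bar R :=
  \int[lebesgue_rV n]_(x in ~` Omega)
    (beta x * g `|u x| * (u x / `|u x|) * v x)%:E.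

(* R^2n \ (Omega^c)^2 *)
Definition star Omega : set ('rV[R]_n * 'rV[R]_n) :=
  ~` (~` Omega `*` ~` Omega).

End modulars.

(* Classes of functions modulo null sets are represented by Borel functions;
   elements of [W_reg] are total functions of which only the values on Omega are
   used. [W_beta] is the space usually written X, for the Robin problem. *)
Section spaces.
Context {R : realType} {n : nat}.
Variables (s : R) (G : R -> R) (beta : 'rV[R]_n -> R) (Omega : set 'rV[R]_n).
Local Open Scope ereal_scope.

Definition W_0 : set ('rV[R]_n -> R) :=
  [set u | [/\ measurable_fun setT u, Phi G setT u < +oo,
     Phi_s s G setT u < +oo &
     {ae lebesgue_rV n, forall x, (~` Omega) x -> u x = 0%R}]].

Definition W_star : set ('rV[R]_n -> R) :=
  [set u | [/\ measurable_fun setT u, Phi G Omega u < +oo &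
     Phi_s s G (star Omega) u < +oo]].

Definition W_reg : set ('rV[R]_n -> R) :=
  [set u | [/\ measurable_fun Omega u, Phi G Omega u < +oo &
     Phi_s s G (Omega `*` Omega) u < +oo]].

Definition W_beta : set ('rV[R]_n -> R) :=
  [set u | W_star u /\ Phi_beta G beta Omega u < +oo].

End spaces.

Section minimization.
Context {R : realType} {n : nat}.
Variables (s : R) (G : R -> R) (beta : 'rV[R]_n -> R) (Omega : set 'rV[R]_n).
Variable mu : R.
Implicit Types (X : set ('rV[R]_n -> R)) (J : ('rV[R]_n -> R) -> \bar R).
Local Open Scope ereal_scope.

Definition constrained X := [set u | X u /\ Phi G Omega u = mu%:E].

Definition quotient J u : \bar R := J u / Phi G Omega u.

Definition level X J : \bar R := ereal_inf (quotient J @` constrained X).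

Definition attains X J u : Prop :=
  constrained X u /\ quotient J u = level X J.

(* D: Dirichlet, N: Neumann, reg: regional Neumann, R: Robin. *)
Definition J_D u := Phi_s s G setT u + Phi G Omega u.
Definition J_N u := Phi_s s G (star Omega) u + Phi G Omega u.
Definition J_reg u := Phi_s s G (Omega `*` Omega) u + Phi G Omega u.
Definition J_R u :=
  Phi_s s G (star Omega) u + Phi G Omega u + Phi_beta G beta Omega u.

Definition Lambda_D := level (W_0 s G Omega) J_D.
Definition Lambda_N := level (W_star s G Omega) J_N.
Definition Lambda_reg := level (W_reg s G Omega) J_reg.
Definition Lambda_R := level (W_beta s G beta Omega) J_R.

Definition attains_D u := attains (W_0 s G Omega) J_D u.
Definition attains_N u := attains (W_star s G Omega) J_N u.
Definition attains_reg u := attains (W_reg s G Omega) J_reg u.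
Definition attains_R u := attains (W_beta s G beta Omega) J_R u.

End minimization.

Section eigenvalues.
Context {R : realType} {n : nat}.
Variables (s : R) (g G : R -> R) (beta : 'rV[R]_n -> R) (Omega : set 'rV[R]_n).
Implicit Types (lambda : R) (u : 'rV[R]_n -> R).
Local Open Scope ereal_scope.

Definition eigen_D lambda u : Prop :=
  W_0 s G Omega u /\ forall v, W_0 s G Omega v ->
    form_s s g setT u v = (lambda - 1)%:E * form_0 g Omega u v.

Definition eigen_N lambda u : Prop :=
  W_star s G Omega u /\ forall v, W_star s G Omega v ->
    form_s s g (star Omega) u v = (lambda - 1)%:E * form_0 g Omega u v.

Definition eigen_reg lambda u : Prop :=
  W_reg s G Omega u /\ forall v, W_reg s G Omega v ->
    form_s s g (Omega `*` Omega) u v = (lambda - 1)%:E * form_0 g Omega u v.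

Definition eigen_R lambda u : Prop :=
  W_beta s G beta Omega u /\ forall v, W_beta s G beta Omega v ->
    form_s s g (star Omega) u v =
      (lambda - 1)%:E * form_0 g Omega u v - form_beta g beta Omega u v.

End eigenvalues.

(* Main.v *)
Require Import Defs.
From HB Require Import structures.
From mathcomp Require Import all_boot all_order all_algebra.
From mathcomp Require Import all_classical all_reals all_analysis.
From mathcomp Require Import measurable_realfun lra.

Set Implicit Arguments.
Unset Strict Implicit.
Unset Printing Implicit Defensive.

Import Order.TTheory GRing.Theory Num.Theory.
Import numFieldNormedType.Exports.

Local Open Scope classical_set_scope.
Local Open Scope ring_scope.

(** Testing each eigenvalue equation with the
eigenfunction [u] itself turns every form into an integral of [g (|f|) |f|]
against a nonnegative weight, where [f] is [u] or its Holder quotient.  The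
growth condition says that [t * g t] lies between [pm * G t] and [pp * G t], so
each form lies between [pm] and [pp] times the corresponding modular
([modular_form_bounds]).  If [a] is the total of the modulars other than
[Phi G Omega u = mu], the equation reads [F = (lambda - 1) * H] with [F]
comparable to [a] and [H] comparable to [mu], whereas the level attained at [u]
is [(a + mu) / mu]; the two-sided bound follows because [pm / pp <= 1]
([eigenvalue_bounds]).

The chain of inequalities between eigenvalues needs
[Lambda_reg <= Lambda_N <= Lambda_R <= Lambda_D].  Each step compares infima
over nested sets of competitors for functionals that are ordered there
([le_level]): the domains of integration satisfy
[Omega * Omega <= star Omega <= R^2n], the Robin term is nonnegative, and it
vanishes on the Dirichlet space.  Passing from one eigenvalue to a level and
from the next level back to its eigenvalue costs one factor [pp / pm] each
([eigenvalue_comparison]).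

The integrals are monotone and homogeneous only for measurable integrands over
measurable domains.  The measurability that is not immediate is that of [Omega],
an open set for the sup norm, in the sigma-algebra of the coordinates
([open_rV_measurable]). *)

(** * Measurability of open sets and of functions of a norm *)

(** The cubes with rational centre and radius [1 / (k + 1)] form a countable
base, and a cube is a finite intersection of preimages under coordinates. *)
Lemma open_rV_measurable (R : realType) (n : nat) (U : set 'rV[R]_n) :
  open U -> measurable U.
Proof.
move=> oU.
pose B (p : 'rV[rat]_n * nat) : set 'rV[R]_n :=
  [set x | forall i, ball (ratr (p.1 ord0 i) : R) p.2.+1%:R^-1 (x ord0 i)].
have mB p : measurable (B p).
  rewrite (_ : B p = \bigcap_(i in [set: 'I_n])
     ((fun x : 'rV[R]_n => x ord0 i) @^-1`
        ball (ratr (p.1 ord0 i) : R) p.2.+1%:R^-1)); last first.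
    by apply/seteqP; split => x Bx i; [move=> _|]; exact: Bx.
  apply: fin_bigcap_measurable; first exact: finite_finset.
  move=> i _; rewrite -[X in measurable X]setTI.
  by apply: measurable_coord => //; exact: measurable_ball.
rewrite (_ : U = \bigcup_p (if pselect (B p `<=` U) then B p else set0)).
  apply: countable_bigcupT_measurable; first exact: countableP.
  by move=> p; case: pselect => ?; [exact: mB|exact: measurable0].
apply/seteqP; split => [x Ux|x [p _]]; last by case: pselect => // BU /BU.
have /nbhs_ballP[e /= e0 xeU] : nbhs x U by exact: open_nbhs_nbhs.
have [k ke] : exists k : nat, k.+1%:R^-1 < e / 2 :> R.
  have e20 : 0 < e / 2 by rewrite divr_gt0.
  exists (Num.truncn (e / 2)^-1); rewrite invf_plt ?posrE//.
  by rewrite truncnS_gt.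
have ex_q i : exists q : rat, ball (ratr q : R) k.+1%:R^-1 (x ord0 i).
  have [q] : exists q : rat,
      ratr q \in `](x ord0 i - k.+1%:R^-1), (x ord0 i + k.+1%:R^-1)[.
    by apply: rat_in_itvoo; rewrite ltrD2l gt0_cp.
  rewrite in_itv/= => /andP[q1 q2]; exists q.
  by rewrite /ball/= ltr_distl q1.
pose q : 'rV[rat]_n := \row_i sval (cid (ex_q i)).
have Bx : B (q, k) x by move=> i /=; rewrite mxE; case: cid.
exists (q, k) => //; case: pselect => //; case => y By.
apply: xeU; split=> // a i; rewrite ord1.
apply: (@ball_splitr _ _ (ratr (q ord0 i) : R)).
  by apply: le_ball (Bx i); exact: ltW.
by apply: le_ball (By i); exact: ltW.
Qed.

(** Monotonicity of [h] is only available on the nonnegative half-line, which is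
all that the Young function and its density provide. *)
Lemma measurable_ndecr_normr d (T : measurableType d) (R : realType)
    (D : set T) (h : R -> R) (f : T -> R) :
  (forall t u, 0 <= t -> t <= u -> h t <= h u) ->
  measurable_fun D f -> measurable_fun D (fun x => h `|f x|).
Proof.
move=> ndh mf.
(* Extended by its value at 0, [h] is monotone on the whole line. *)
rewrite (_ : (fun x => _) = (fun t => h (Num.max 0 t)) \o (fun x => `|f x|)).
  apply: measurableT_comp; last exact: measurableT_comp.
  apply: nondecreasing_measurable => // t u tu.
  apply: ndh; first by rewrite le_max lexx.
  by rewrite ge_max !le_max lexx tu orbT.
by apply/funext => x /=; rewrite max_r.
Qed.

(** Division by 0 is 0, so the identity also holds at [r = 0]. *)
Lemma mulr_div_normr (R : realType) (r : R) : r / `|r| * r = `|r|.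
Proof.
have [->|r0] := eqVneq r 0; first by rewrite normr0 mulr0.
by rewrite mulrAC -expr2 -(real_normK (num_real r)) expr2 mulfK// normr_eq0.
Qed.

(** * Young functions and the growth condition *)

Section young.
Context (R : realType) (g G : R -> R).
Hypothesis young_G : young_function g G.

Lemma young_density_ge0 t : 0 <= t -> 0 <= g t.
Proof.
by move=> t0; rewrite -(young_g0 young_G); exact: (young_ndecr young_G).
Qed.

Lemma young_zero : G 0 = 0.
Proof.
apply: EFin_inj; rewrite (young_primitive young_G)// set_itv1.
by rewrite integral_set1.
Qed.

Lemma young_ge0 t : 0 <= t -> 0 <= G t.
Proof.
move=> t0; rewrite -lee_fin (young_primitive young_G)//.
apply: integral_ge0 => x /=; rewrite in_itv/= => /andP[x0 _].
by rewrite lee_fin young_density_ge0.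
Qed.

Lemma young_ndecreasing t u : 0 <= t -> t <= u -> G t <= G u.
Proof.
move=> t0 tu; rewrite -lee_fin !(young_primitive young_G) ?(le_trans t0)//.
apply: ge0_subset_integral => //=.
- apply/measurable_EFinP.
  apply: (eq_measurable_fun (fun x : measurableTypeR R => g `|x|)).
    by move=> x; rewrite inE/= in_itv/= => /andP[x0 _]; rewrite ger0_norm.
  by apply: measurable_ndecr_normr => //; exact: (young_ndecr young_G).
- move=> x; rewrite in_itv/= => /andP[x0 _].
  by rewrite lee_fin young_density_ge0.
- by apply: subset_itvl; rewrite bnd_simp.
Qed.

Context (pm pp : R).
Hypothesis pm_gt1 : 1 < pm.
Hypothesis growth_G : forall t : R, 0 < t -> pm <= t * g t / G t <= pp.

Lemma growth_exponents_le : pm <= pp.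
Proof. by have /andP[/le_trans] := growth_G ltr01; apply. Qed.

(** The growth condition in the form in which it is integrated: the middle term
is [t * g t] at [t = `|r|]. *)
Lemma growth_bounds r :
  pm * G `|r| <= g `|r| * (r / `|r|) * r <= pp * G `|r|.
Proof.
have [->|r0] := eqVneq r 0; first by rewrite normr0 young_zero !mulr0 lexx.
have r_gt0 : 0 < `|r| by rewrite normr_gt0.
rewrite -mulrA mulr_div_normr.
have gr := growth_G r_gt0.
(* A zero of [G] at a positive point would make the growth ratio 0 < pm. *)
have G_gt0 : 0 < G `|r|.
  rewrite lt_neqAle young_ge0// andbT eq_sym; apply/eqP => G0.
  move: gr; rewrite G0 invr0 mulr0 => /andP[/(lt_le_trans pm_gt1)].
  by rewrite ltr10.
by move: gr; rewrite ler_pdivlMr// ler_pdivrMr// (mulrC `|r|).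
Qed.

Section modular.
Context d (T : measurableType d) (m : {measure set T -> \bar R}).
Context (D : set T) (w f : T -> R).
Hypotheses (mD : measurable D) (mw : measurable_fun D w).
Hypothesis mf : measurable_fun D f.

Let measurable_modular (v : T -> R) : measurable_fun D v ->
  measurable_fun D (fun x => (v x * G `|f x|)%:E).
Proof.
move=> mv; apply/measurable_EFinP; apply: measurable_funM => //.
by apply: measurable_ndecr_normr => //; exact: young_ndecreasing.
Qed.

Let measurable_form (v : T -> R) : measurable_fun D v ->
  measurable_fun D (fun x => (v x * (g `|f x| * (f x / `|f x|) * f x))%:E).
Proof.
move=> mv; apply/measurable_EFinP; apply: measurable_funM => //.
rewrite (_ : (fun x => _) = (fun x => g `|f x| * `|f x|)).
  apply: measurable_funM; last exact: measurableT_comp.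
  by apply: measurable_ndecr_normr => //; exact: (young_ndecr young_G).
by apply/funext => x; rewrite -mulrA mulr_div_normr.
Qed.

(** One statement for all the forms tested with [v = u]: the weight [w] is 1,
the singular kernel, or [beta].  Nonnegativity almost everywhere is what
is known of [beta]. *)
Lemma modular_form_bounds :
  {ae m, forall x, D x -> 0 <= w x} ->
  let I := (\int[m]_(x in D) (w x * G `|f x|)%:E)%E in
  let K :=
    (\int[m]_(x in D) (w x * (g `|f x| * (f x / `|f x|) * f x))%:E)%E in
  [/\ (0 <= I)%E, (pm%:E * I <= K)%E & (K <= pp%:E * I)%E].
Proof.
move=> w0.
have pm0 : 0 <= pm by exact/ltW/(lt_trans ltr01).
have pp0 : 0 <= pp := le_trans pm0 growth_exponents_le.
have mw' : measurable_fun D (fun x => `|w x|) by exact: measurableT_comp.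
(* Trading [w] for [`|w|] makes the integrands nonnegative everywhere. *)
have eqw (h : T -> R) : measurable_fun D (fun x => (w x * h x)%:E) ->
    measurable_fun D (fun x => (`|w x| * h x)%:E) ->
    (\int[m]_(x in D) (w x * h x)%:E = \int[m]_(x in D) (`|w x| * h x)%:E)%E.
  move=> m1 m2; apply: ae_eq_integral => //.
  by apply: filterS w0 => x w0 Dx; rewrite ger0_norm// w0.
rewrite /= eqw; [|exact: measurable_modular..].
rewrite eqw; [|exact: measurable_form..].
have I0 x : D x -> (0 <= (`|w x| * G `|f x|)%:E)%E.
  by move=> _; rewrite lee_fin mulr_ge0// young_ge0.
split; first exact: integral_ge0.
- rewrite -ge0_integralZl//; last exact: measurable_modular.
  apply: ge0_le_integral => //.
  + by move=> x Dx; rewrite mule_ge0 ?lee_fin// -lee_fin I0.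
  + by apply: measurable_funeM; exact: measurable_modular.
  + exact: measurable_form.
  move=> x Dx; rewrite -EFinM lee_fin mulrCA ler_wpM2l//.
  by have /andP[] := growth_bounds (f x).
- rewrite -ge0_integralZl//; last exact: measurable_modular.
  apply: ge0_le_integral => //.
  + move=> x Dx; rewrite lee_fin mulr_ge0//.
    have /andP[+ _] := growth_bounds (f x); apply: le_trans.
    by rewrite mulr_ge0// young_ge0.
  + exact: measurable_form.
  + by apply: measurable_funeM; exact: measurable_modular.
  move=> x Dx; rewrite -EFinM lee_fin [leRHS]mulrCA ler_wpM2l//.
  by have /andP[] := growth_bounds (f x).
Qed.

End modular.
End young.

(** * The singular kernel and the Holder quotient *)

Section kernel.
Context {R : realType} {n : nat}.
Implicit Types (u : 'rV[R]_n -> R) (U : set 'rV[R]_n).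

(** Square roots, inverses and fractional powers of a nonnegative measurable
function are all handled as real powers, here and below. *)
Lemma measurable_distance :
  measurable_fun setT (fun z : 'rV[R]_n * 'rV[R]_n => enorm (z.1 - z.2)).
Proof.
rewrite (_ : (fun z => _) = fun z : 'rV[R]_n * 'rV[R]_n =>
    (\sum_i (z.1 ord0 i - z.2 ord0 i) ^+ 2) `^ 2^-1); last first.
  apply/funext => z; rewrite /enorm powR12_sqrt.
    by congr Num.sqrt; apply: eq_bigr => i _; rewrite !mxE.
  by apply: sumr_ge0 => i _; exact: sqr_ge0.
apply: (measurableT_comp (measurable_powR _)).
apply: measurable_sum => i; apply: measurable_funX.
apply: measurable_funB.
- by apply: (measurableT_comp (measurable_coord i)); exact: measurable_fst.
- by apply: (measurableT_comp (measurable_coord i)); exact: measurable_snd.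
Qed.

Lemma kernel_ge0 (z : 'rV[R]_n * 'rV[R]_n) :
  0 <= (enorm (z.1 - z.2) ^+ n)^-1.
Proof. by rewrite invr_ge0 exprn_ge0// sqrtr_ge0. Qed.

Lemma measurable_kernel : measurable_fun setT
  (fun z : 'rV[R]_n * 'rV[R]_n => (enorm (z.1 - z.2) ^+ n)^-1).
Proof.
rewrite (_ : (fun z => _) =
  (fun z => (enorm (z.1 - z.2) ^+ n) `^ (- 1))); last first.
  apply/funext => z; rewrite powR_inv1//.
  by rewrite exprn_ge0// sqrtr_ge0.
apply: (measurableT_comp (measurable_powR _)).
by apply: measurable_funX; exact: measurable_distance.
Qed.

(** Stated on [U * U] because elements of the regional space are only measurable
on [Omega]. *)
Lemma measurable_Ds s u U : measurable U -> measurable_fun U u ->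
  measurable_fun (U `*` U) (Ds s u).
Proof.
move=> mU mfu.
have mUU : measurable (U `*` U) by exact: measurableX.
rewrite (_ : Ds s u = fun z => (u z.1 - u z.2) * enorm (z.1 - z.2) `^ (- s)).
  apply: measurable_funM; first apply: measurable_funB.
  - apply: (@measurable_comp _ _ _ _ _ _ U u (U `*` U) fst) => //.
      by move=> _ [z [? ?] <-].
    by apply: measurable_funTS; exact: measurable_fst.
  - apply: (@measurable_comp _ _ _ _ _ _ U u (U `*` U) snd) => //.
      by move=> _ [z [? ?] <-].
    by apply: measurable_funTS; exact: measurable_snd.
  apply: (measurableT_comp (measurable_powR _)).
  by apply: measurable_funTS; exact: measurable_distance.
by apply/funext => z; rewrite /Ds powRN.
Qed.

End kernel.

(** * Forms and modulars *)

Section modulars.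
Context (R : realType) (n : nat) (s : R) (g G : R -> R).
Hypothesis young_G : young_function g G.
Context (pm pp : R).
Hypothesis pm_gt1 : 1 < pm.
Hypothesis growth_G : forall t : R, 0 < t -> pm <= t * g t / G t <= pp.
Implicit Types (Omega : set 'rV[R]_n) (E : set ('rV[R]_n * 'rV[R]_n)).
Implicit Types (beta u : 'rV[R]_n -> R).
Local Open Scope ereal_scope.

Lemma Phi_form_bounds Omega u : measurable Omega -> measurable_fun Omega u ->
  [/\ 0 <= Phi G Omega u,
      pm%:E * Phi G Omega u <= form_0 g Omega u u &
      form_0 g Omega u u <= pp%:E * Phi G Omega u].
Proof.
move=> mO mfu.
have := @modular_form_bounds _ _ _ young_G _ _ pm_gt1 growth_G _ _
  (lebesgue_rV n) Omega (fun=> 1%R) u mO (measurable_cst _) mfu.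
rewrite (_ : \int[_]_(x in _) (1 * G _)%:E = Phi G Omega u); last first.
  by apply: eq_integral => x _; rewrite mul1r.
rewrite (_ : \int[_]_(x in _) (1 * _)%:E = form_0 g Omega u u); last first.
  by apply: eq_integral => x _; rewrite mul1r.
by apply; apply: aeW.
Qed.

Lemma Phi_beta_form_bounds beta Omega u : measurable Omega ->
  measurable_fun (~` Omega) beta ->
  {ae lebesgue_rV n, forall x, (~` Omega) x -> (0 < beta x)%R} ->
  measurable_fun (~` Omega) u ->
  [/\ 0 <= Phi_beta G beta Omega u,
      pm%:E * Phi_beta G beta Omega u <= form_beta g beta Omega u u &
      form_beta g beta Omega u u <= pp%:E * Phi_beta G beta Omega u].
Proof.
move=> mO mb b0 mfu.
have := @modular_form_bounds _ _ _ young_G _ _ pm_gt1 growth_G _ _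
  (lebesgue_rV n) (~` Omega) beta u (measurableC mO) mb mfu.
rewrite (_ : \int[_]_(x in _) (beta x * (g _ * _ * _))%:E =
             form_beta g beta Omega u u); last first.
  by apply: eq_integral => x _; rewrite !mulrA.
by apply; apply: filterS b0 => x b0 /b0 /ltW.
Qed.

Lemma Phi_s_form_bounds E u : measurable E -> measurable_fun E (Ds s u) ->
  [/\ 0 <= Phi_s s G E u,
      pm%:E * Phi_s s G E u <= form_s s g E u u &
      form_s s g E u u <= pp%:E * Phi_s s G E u].
Proof.
move=> mE mD.
have := @modular_form_bounds _ _ _ young_G _ _ pm_gt1 growth_G _ _
  (lebesgue_rV n \x lebesgue_rV n) E
  (fun z => (enorm (z.1 - z.2) ^+ n)^-1)%R (Ds s u) mE
  (measurable_funTS measurable_kernel) mD.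
rewrite (_ : \int[_]_(z in _) (_ * G _)%:E = Phi_s s G E u); last first.
  by apply: eq_integral => z _; rewrite mulrC.
rewrite (_ : \int[_]_(z in _) (_ * (g _ * _ * _))%:E = form_s s g E u u);
    last first.
  by apply: eq_integral => z _; rewrite mulrC.
by apply; apply: aeW => z _; exact: kernel_ge0.
Qed.

End modulars.

(** * Eigenvalues and levels *)

(** Here [a] is the energy other than [mu], so that [(a + mu) / mu] is the
attained level, [F] the left side of the equation tested with the eigenfunction,
and [H] the factor of [lambda - 1].  Since [pm <= pp], the term [mu] can be
weighted by either exponent:
[pp * mu * lambda >= pp * mu + F >= pm * (a + mu)], and symmetrically for the
upper bound. *)
Lemma eigenvalue_bounds (R : realType) (pm pp mu lambda : R) (a F H : \bar R) :
  1 < pm -> pm <= pp -> 0 < mu -> (0 <= a < +oo)%E ->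
  (pm%:E * a <= F <= pp%:E * a)%E ->
  (pm%:E * mu%:E <= H <= pp%:E * mu%:E)%E ->
  F = ((lambda - 1)%:E * H)%E ->
  ((pm / pp)%:E * ((a + mu%:E) / mu%:E) <= lambda%:E
     <= (pp / pm)%:E * ((a + mu%:E) / mu%:E))%E.
Proof.
move=> pm1 pmpp mu0.
case: a => [a| |]; [|by move=> /andP[]..].
have pm0 : 0 < pm by exact: lt_trans pm1.
have pp0 : 0 < pp by exact: lt_le_trans pmpp.
case: H => [H| |]; first last.
- by rewrite -!EFinM leeNy_eq => _ _ /andP[].
- by rewrite -EFinM leye_eq => _ _ /andP[].
case: F => [F| |] //.
rewrite -!EFinM !lee_fin inver gt_eqF// -EFinD -!EFinM !lee_fin.
move=> /andP[a0 _] /andP[aF Fa] /andP[mH Hm] [FE].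
have F0 : 0 <= F by apply: le_trans aF; rewrite mulr_ge0// ltW.
have H0 : 0 < H by apply: lt_le_trans mH; rewrite mulr_gt0.
have l1 : 0 <= lambda - 1 by rewrite -(pmulr_lge0 _ H0) -FE.
have lmH : pm * mu * (lambda - 1) <= F by rewrite FE mulrC ler_wpM2l.
have lHm : F <= pp * mu * (lambda - 1) by rewrite FE mulrC ler_wpM2r.
have mm : pm * mu <= pp * mu by rewrite ler_pM2r.
have aa : pm * a <= pp * a by rewrite ler_wpM2r.
apply/andP; split.
- rewrite mulf_div ler_pdivrMr ?mulr_gt0// mulrDr.
  by move: lHm; rewrite mulrBr mulr1; lra.
- rewrite mulf_div ler_pdivlMr ?mulr_gt0// mulrDr.
  by move: lmH; rewrite mulrBr mulr1; lra.
Qed.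

(** The levels are extended reals; the real bounds [l1] and [l2] exclude
infinite values of [L2]. *)
Lemma eigenvalue_comparison (R : realType) (c l1 l2 : R) (L1 L2 : \bar R) :
  0 < c -> (l1%:E <= c%:E * L1)%E -> (L1 <= L2)%E ->
  (c^-1%:E * L2 <= l2%:E)%E -> l1 <= c ^+ 2 * l2.
Proof.
move=> c0 l1L1 L12 L2l2.
have : (l1%:E <= c%:E * L2)%E.
  by apply: le_trans l1L1 _; rewrite lee_pmul2l.
case: L2 {L12} L2l2 => [L| |].
- rewrite -!EFinM !lee_fin ler_pdivrMl// => Ll2 /le_trans; apply.
  by rewrite expr2 -mulrA ler_pM2l.
- by rewrite gt0_muley ?lte_fin ?invr_gt0// leye_eq.
- by move=> _; rewrite gt0_muleNy ?lte_fin// leeNy_eq.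
Qed.

(** * Comparison of the levels *)

Section levels.
Context (R : realType) (n : nat) (s : R) (g G : R -> R).
Hypothesis young_G : young_function g G.
Context (beta : 'rV[R]_n -> R) (Omega : set 'rV[R]_n) (mu : R).
Hypothesis mOmega : measurable Omega.
Implicit Types (X Y : set ('rV[R]_n -> R)) (J K : ('rV[R]_n -> R) -> \bar R).
Implicit Types (u : 'rV[R]_n -> R).
Local Open Scope ereal_scope.

Lemma le_level X Y J K : (0 < mu)%R ->
  (forall u, Y u -> X u /\ J u <= K u) ->
  level G Omega mu X J <= level G Omega mu Y K.
Proof.
move=> mu0 YX; apply/ereal_infP => _ [u [Yu Pu] <-].
have [Xu JK] := YX _ Yu; apply: (@le_trans _ _ (quotient G Omega J u)).
  by apply: ereal_inf_lbound; exists u.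
by rewrite /quotient Pu inver gt_eqF// lee_pmul2r// lte_fin invr_gt0.
Qed.

Lemma le_Phi (A B : set 'rV[R]_n) u : measurable A -> measurable B ->
  measurable_fun B u -> A `<=` B -> Phi G A u <= Phi G B u.
Proof.
move=> mA mB mfu AB; apply: ge0_subset_integral => //.
  apply/measurable_EFinP; apply: measurable_ndecr_normr mfu.
  exact: young_ndecreasing young_G.
by move=> x _; rewrite lee_fin (young_ge0 young_G).
Qed.

Lemma le_Phi_s (A B : set ('rV[R]_n * 'rV[R]_n)) u :
  measurable A -> measurable B ->
  measurable_fun setT u -> A `<=` B -> Phi_s s G A u <= Phi_s s G B u.
Proof.
move=> mA mB mfu AB; apply: ge0_subset_integral => //.
  apply/measurable_EFinP; apply: measurable_funM; last first.
    by apply: measurable_funTS; exact: measurable_kernel.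
  apply: measurable_ndecr_normr; first exact: young_ndecreasing young_G.
  by apply: measurable_funTS; rewrite -setXTT; exact: measurable_Ds.
by move=> z _; rewrite lee_fin mulr_ge0 ?kernel_ge0// (young_ge0 young_G).
Qed.

Lemma measurable_star : measurable (star Omega).
Proof.
by apply: measurableC; apply: measurableX; exact: measurableC.
Qed.

Lemma setXX_star : Omega `*` Omega `<=` star Omega.
Proof. by move=> z [z1 _] [/(_ z1)]. Qed.

(** This is why a Dirichlet competitor is admissible for the Robin problem and
pays nothing for the boundary term. *)
Lemma Phi_beta_Dirichlet u : measurable_fun (~` Omega) beta ->
  measurable_fun setT u ->
  {ae lebesgue_rV n, forall x, (~` Omega) x -> u x = 0%R} ->
  Phi_beta G beta Omega u = 0.
Proof.
move=> mb mfu u0; rewrite -(integral0 (lebesgue_rV n) (~` Omega)).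
apply: ae_eq_integral => //.
- exact: measurableC.
- apply/measurable_EFinP; apply: measurable_funM => //.
  apply: measurable_ndecr_normr; first exact: young_ndecreasing young_G.
  exact: measurable_funTS.
- apply: filterS u0 => x u0 /u0 ->.
  by rewrite normr0 (young_zero young_G) mulr0.
Qed.

Lemma Lambda_reg_le_N : (0 < mu)%R ->
  Lambda_reg s G Omega mu <= Lambda_N s G Omega mu.
Proof.
move=> mu0; apply: le_level => // u [mfu Pu Psu].
have le_s : Phi_s s G (Omega `*` Omega) u <= Phi_s s G (star Omega) u.
  apply: le_Phi_s => //; [exact: measurableX|exact: measurable_star|].
  exact: setXX_star.
split; last by rewrite leeD2r.
by split => //; [exact: measurable_funTS|exact: le_lt_trans Psu].
Qed.

Lemma Lambda_N_le_R : (0 < mu)%R ->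
  (forall u, measurable_fun setT u -> 0 <= Phi_beta G beta Omega u) ->
  Lambda_N s G Omega mu <= Lambda_R s G beta Omega mu.
Proof.
move=> mu0 b0; apply: le_level => // u [Wu _]; split => //.
by have [mfu _ _] := Wu; rewrite leeDl// b0.
Qed.

Lemma Lambda_R_le_D : (0 < mu)%R -> measurable_fun (~` Omega) beta ->
  Lambda_R s G beta Omega mu <= Lambda_D s G Omega mu.
Proof.
move=> mu0 mb; apply: le_level => // u [mfu Pu Psu u0].
have le_s : Phi_s s G (star Omega) u <= Phi_s s G setT u.
  by apply: le_Phi_s => //; exact: measurable_star.
have Pb : Phi_beta G beta Omega u = 0 by exact: Phi_beta_Dirichlet.
split; last by rewrite /J_R /J_D Pb adde0 leeD2r.
split; last by rewrite Pb.
split => //; last exact: le_lt_trans Psu.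
by apply: le_lt_trans Pu; exact: le_Phi.
Qed.

End levels.

(** * Bounds and chain of inequalities *)

Theorem proposition5p8 (R : realType) (n : nat) (n_gt0 : (0 < n)%N)
  (s : R) (s_gt0 : 0 < s) (s_lt1 : s < 1)
  (Omega : set 'rV[R]_n)
  (Omega_open : open Omega) (Omega_bounded : bounded_set Omega)
  (Omega_lipschitz : lipschitz_boundary Omega)
  (beta : 'rV[R]_n -> R)
  (beta_measurable : measurable_fun (~` Omega) beta)
  (beta_bounded : exists M : R,
     {ae lebesgue_rV n, forall x, (~` Omega) x -> `|beta x| <= M})
  (beta_gt0 : {ae lebesgue_rV n, forall x, (~` Omega) x -> 0 < beta x})
  (g G : R -> R) (young_G : young_function g G)
  (pm pp : R) (pm_gt1 : 1 < pm)
  (growth_G : forall t : R, 0 < t -> pm <= t * g t / G t <= pp)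
  (convex_G : convex_function (`[0, +oo[%classic : set R)
     (fun t : R => G (Num.sqrt t)))
  (inv_G : young_inv_growth n s G)
  (mu : R) (mu_gt0 : 0 < mu)
  (lambda_D lambda_N lambda_reg lambda_R : R)
  (u_D u_N u_reg u_R : 'rV[R]_n -> R)
  (min_D : attains_D s G Omega mu u_D)
  (min_N : attains_N s G Omega mu u_N)
  (min_reg : attains_reg s G Omega mu u_reg)
  (min_R : attains_R s G beta Omega mu u_R)
  (eig_D : eigen_D s g G Omega lambda_D u_D)
  (eig_N : eigen_N s g G Omega lambda_N u_N)
  (eig_reg : eigen_reg s g G Omega lambda_reg u_reg)
  (eig_R : eigen_R s g G beta Omega lambda_R u_R) :
  [/\ ((pm / pp)%:E * Lambda_D s G Omega mu <= lambda_D%:E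
         <= (pp / pm)%:E * Lambda_D s G Omega mu)%E,
      ((pm / pp)%:E * Lambda_R s G beta Omega mu <= lambda_R%:E
         <= (pp / pm)%:E * Lambda_R s G beta Omega mu)%E,
      ((pm / pp)%:E * Lambda_N s G Omega mu <= lambda_N%:E
         <= (pp / pm)%:E * Lambda_N s G Omega mu)%E &
      ((pm / pp)%:E * Lambda_reg s G Omega mu <= lambda_reg%:E
         <= (pp / pm)%:E * Lambda_reg s G Omega mu)%E]
  /\ (let c := pp / pm in
      [/\ lambda_reg <= c ^+ 2 * lambda_N,
          c ^+ 2 * lambda_N <= c ^+ 4 * lambda_R &
          c ^+ 4 * lambda_R <= c ^+ 6 * lambda_D]).
Proof.
have mO : measurable Omega by exact: open_rV_measurable.
have mOO : measurable (Omega `*` Omega) by exact: measurableX.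
have mS := measurable_star mO.
have pmpp : pm <= pp by exact: growth_exponents_le growth_G.
have pm0 : 0 < pm by exact: lt_trans pm_gt1.
have pp0 : 0 < pp by exact: lt_le_trans pmpp.
have bP := Phi_form_bounds young_G pm_gt1 growth_G mO.
have bS := Phi_s_form_bounds (n := n) (s := s) young_G pm_gt1 growth_G.
have bB u (mfu : measurable_fun setT u) := Phi_beta_form_bounds young_G
  pm_gt1 growth_G mO beta_measurable beta_gt0 (measurable_funTS mfu).
have mDT u (E : set ('rV[R]_n * 'rV[R]_n)) :
    measurable_fun setT u -> measurable_fun E (Ds s u).
  by move=> mfu; apply: measurable_funTS; rewrite -setXTT; exact: measurable_Ds.
(* The part common to the four problems; [a] is the energy without [mu] and [F]
   the form paired with it. *)
have bounds (J : ('rV[R]_n -> R) -> \bar R) X u lambda a F :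
    attains G Omega mu X J u -> measurable_fun Omega u ->
    J u = (a + Phi G Omega u)%E -> (a < +oo)%E ->
    [/\ (0 <= a)%E, (pm%:E * a <= F)%E & (F <= pp%:E * a)%E] ->
    F = ((lambda - 1)%:E * form_0 g Omega u u)%E ->
    ((pm / pp)%:E * level G Omega mu X J <= lambda%:E
       <= (pp / pm)%:E * level G Omega mu X J)%E.
  move=> [[_ Pu] <-] mfu Ju aoo [a0 aF Fa] FE.
  rewrite /quotient Ju Pu; apply: eigenvalue_bounds FE => //.
  - by rewrite a0 aoo.
  - by rewrite aF Fa.
  - by have [_ + +] := bP _ mfu; rewrite Pu => -> ->.
have bD : ((pm / pp)%:E * Lambda_D s G Omega mu <= lambda_D%:E
         <= (pp / pm)%:E * Lambda_D s G Omega mu)%E.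
  have [Wu Eu] := eig_D; have [mfu _ Psu _] := Wu.
  apply: (bounds _ _ _ _ _ _ min_D _ erefl Psu _ (Eu _ Wu)).
    exact: measurable_funTS.
  by apply: bS => //; exact: mDT.
have bN : ((pm / pp)%:E * Lambda_N s G Omega mu <= lambda_N%:E
         <= (pp / pm)%:E * Lambda_N s G Omega mu)%E.
  have [Wu Eu] := eig_N; have [mfu _ Psu] := Wu.
  apply: (bounds _ _ _ _ _ _ min_N _ erefl Psu _ (Eu _ Wu)).
    exact: measurable_funTS.
  by apply: bS => //; exact: mDT.
have breg : ((pm / pp)%:E * Lambda_reg s G Omega mu <= lambda_reg%:E
         <= (pp / pm)%:E * Lambda_reg s G Omega mu)%E.
  have [Wu Eu] := eig_reg; have [mfu _ Psu] := Wu.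
  apply: (bounds _ _ _ _ _ _ min_reg mfu erefl Psu _ (Eu _ Wu)).
  by apply: bS => //; exact: measurable_Ds.
have bR : ((pm / pp)%:E * Lambda_R s G beta Omega mu <= lambda_R%:E
         <= (pp / pm)%:E * Lambda_R s G beta Omega mu)%E.
  have [Wu Eu] := eig_R; have [[mfu _ Psu] Pbu] := Wu.
  have [s0 s1 s2] := bS _ _ mS (mDT _ _ mfu).
  have [b0 b1 b2] := bB _ mfu.
  (* Finiteness allows the Robin term to be moved to the other side. *)
  have bfin : form_beta g beta Omega u_R u_R \is a fin_num.
    rewrite ge0_fin_numE.
      by apply: le_lt_trans b2 _; rewrite lte_mul_pinfty ?lee_fin ?ltW.
    by apply: le_trans b1; rewrite mule_ge0 // lee_fin ltW.
  apply: (bounds _ _ _ _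
    (Phi_s s G (star Omega) u_R + Phi_beta G beta Omega u_R)%E
    (form_s s g (star Omega) u_R u_R + form_beta g beta Omega u_R u_R)%E
    min_R).
  - exact: measurable_funTS.
  - by rewrite /J_R addeAC.
  - exact: lte_add_pinfty.
  - split; first exact: adde_ge0.
    + by rewrite ge0_muleDr//; exact: leeD.
    + by rewrite ge0_muleDr//; exact: leeD.
  - by rewrite (Eu _ Wu) subeK.
split => // c.
have c0 : 0 < c by rewrite divr_gt0.
have cV : c^-1 = pm / pp by rewrite invf_div.
have compare l1 l2 L1 L2 : (l1%:E <= c%:E * L1)%E -> (L1 <= L2)%E ->
    ((pm / pp)%:E * L2 <= l2%:E)%E -> l1 <= c ^+ 2 * l2.
  by rewrite -cV; exact: eigenvalue_comparison.
move: bD bN breg bR => /andP[bD _] /andP[bN bN1] /andP[_ breg] /andP[bR bR1].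
have NR : lambda_N <= c ^+ 2 * lambda_R.
  apply: compare bN1 _ bR; apply: Lambda_N_le_R => // u mfu.
  by have [] := bB _ mfu.
have RD : lambda_R <= c ^+ 2 * lambda_D.
  apply: compare bR1 _ bD; exact: (Lambda_R_le_D s young_G).
split.
- apply: compare breg _ bN; exact: (Lambda_reg_le_N s young_G).
- by rewrite (exprD c 2 2) -mulrA ler_pM2l ?exprn_gt0.
- by rewrite (exprD c 4 2) -mulrA ler_pM2l ?exprn_gt0.
Qed.
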